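(* Let $(X,\triangleright)$ be a shelf, let $I\subseteq\mathbb{Z}^+$ and, for all $i,j\in I$, let $\alpha_{ij}:X\to X$ be maps such that, for all $a,b\in X$ and $i,j,h\in I$, $$\alpha_{ih}(a)\triangleright\alpha_{jh}(b)=\alpha_{jh}\big(\alpha_{ij}(a)\triangleright b\big).$$ Define, for all $a,b\in X$ and $i,j\in I$, the binary operation $a\triangleright_{z_{ij}}b:=\alpha_{ij}(a)\triangleright b$. Then $(X,\triangleright_{z_{ij}})$ is a $p$-shelf. Moreover, if $(X,\triangleright)$ is a rack, then $(X,\triangleright_{z_{ij}})$ is a $p$-rack.
   Context: A (left) shelf is a non-empty set $X$ with a binary operation $\triangleright$ such that $a\triangleright(b\triangleright c)=(a\triangleright b)\triangleright(a\triangleright c)$ for all $a,b,c\in X$; it is a (left) rack if moreover all maps $b\mapsto a\triangleright b$ ($a\in X$) are bijective. A parametric family of binary operations $\triangleright_{z_{ij}}$ on a non-empty set $X$ depends on an ordered pair of parameters $(z_i,z_j)$; here the parameters are indexed by $i,j\in I$. The pair $(X,\triangleright_{z_{ij}})$ is a (left) $p$-shelf if for all $a,b,c\in X$ and all $i,j,k$ (in the parameter index set) $$a\triangleright_{z_{ik}}(b\triangleright_{z_{jk}}c)=(a\triangleright_{z_{ij}}b)\triangleright_{z_{jk}}(a\triangleright_{z_{ik}}c).$$ A $p$-shelf is a (left) $p$-rack if all maps $L_a^{z_{ij}}:X\to X$, $b\mapsto a\triangleright_{z_{ij}}b$, are bijective. *)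

(* Defs.v *)
From mathcomp Require Import all_boot.
From mathcomp Require Import classical_sets.

Set Implicit Arguments.
Unset Strict Implicit.
Unset Printing Implicit Defensive.

Local Open Scope classical_set_scope.

Definition is_shelf (X : Type) (op : X -> X -> X) : Prop :=
  [set: X] !=set0 /\
  forall a b c : X, op a (op b c) = op (op a b) (op a c).

Definition is_rack (X : Type) (op : X -> X -> X) : Prop :=
  is_shelf op /\ forall a : X, bijective (op a).

(* [op i j a b] stands for the operation with parameters (z_i, z_j) applied
   to a and b. The family is a total function of the indices, but only its
   values at indices in [I] are constrained. *)
Definition is_pshelf (K : Type) (I : set K) (X : Type)
    (op : K -> K -> X -> X -> X) : Prop :=
  [set: X] !=set0 /\
  forall (a b c : X) (i j k : K), I i -> I j -> I k ->
    op i k a (op j k b c) = op j k (op i j a b) (op i k a c).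

Definition is_prack (K : Type) (I : set K) (X : Type)
    (op : K -> K -> X -> X -> X) : Prop :=
  is_pshelf I op /\
  forall (a : X) (i j : K), I i -> I j -> bijective (op i j a).

Definition twisted_op (K X : Type) (op : X -> X -> X) (alpha : K -> K -> X -> X)
    (i j : K) (a b : X) : X :=
  op (alpha i j a) b.

(* Main.v *)
Require Import Defs.
From mathcomp Require Import all_boot.
From mathcomp Require Import classical_sets.

Set Implicit Arguments.
Unset Strict Implicit.
Unset Printing Implicit Defensive.

Local Open Scope classical_set_scope.

Theorem theorem1p6 (X : Type) (op : X -> X -> X) (hX : is_shelf op)
    (I : set nat) (hI : I `<=` [set n : nat | 0 < n])
    (alpha : nat -> nat -> X -> X)
    (halpha : forall (a b : X) (i j h : nat), I i -> I j -> I h ->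
      op (alpha i h a) (alpha j h b) = alpha j h (op (alpha i j a) b)) :
  is_pshelf I (twisted_op op alpha) /\
  (is_rack op -> is_prack I (twisted_op op alpha)).
Proof.
case: hX => X_neq0 opD.
have pshelf : is_pshelf I (twisted_op op alpha).
  split=> // a b c i j k Ii Ij Ik.
  (* Self-distributivity turns the left side into [op (op (alpha i k a) (alpha j k b)) (op (alpha i
     k a) c)]. Then [halpha] with [h := k] pulls [alpha j k] out of the first argument, leaving the
     twisted product of [a] and [b] at [i], [j] inside it. *)
  by rewrite /twisted_op opD halpha.
(* Left translation by [a] in the twisted operation is, up to conversion, left translation by
   [alpha i j a] in [op]. *)
by split=> // -[_ op_bij]; split=> // a i j _ _; exact: op_bij.
Qed.
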